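(* Let $X$ be a topological space, let $f : S \to X$ be a function, let $x\in X$, and let $\mathcal{I}, \mathcal{K}$ be two ideals on $S$ such that $\mathcal{I} \cup \mathcal{K}$ is an ideal. Then: (i) $f$ is $\mathcal{I}^{\mathcal{K}^*}$-convergent to $x$ if and only if $f$ is $(\mathcal{I} \cup \mathcal{K})^*$-convergent to $x$. (ii) If $f$ is $\mathcal{I}^{\mathcal{K}}$-convergent to $x$, then $f$ is $(\mathcal{I} \cup \mathcal{K})$-convergent to $x$.
   Context: $S$ is a set. An ideal on $S$ is a family of subsets of $S$ closed under finite unions and under taking subsets; throughout, ideals are assumed proper ($S$ is not a member) and to contain $Fin$, the family of all finite subsets of $S$. For an ideal $\mathcal{I}$, $\mathcal{I}^*=\{A\subseteq S : S\setminus A\in\mathcal{I}\}$. For ideals $\mathcal{I},\mathcal{K}$ on $S$, the notation $\mathcal{I}\cup\mathcal{K}$ denotes the family $\{I\cup K : I\in\mathcal{I}, K\in\mathcal{K}\}$; saying that it is an ideal means it is a proper ideal, equivalently $S\neq I\cup K$ for all $I\in\mathcal{I}$, $K\in\mathcal{K}$ (the ''ideality condition''). For an ideal $\mathcal{J}$ on $S$, $f:S\to X$ is $\mathcal{J}$-convergent to $x$ if $\{s\in S: f(s)\notin U\}\in\mathcal{J}$ for every neighborhood $U$ of $x$. For a convergence mode $\mathcal{M}$, $f$ is $\mathcal{I}^{\mathcal{M}}$-convergent to $x$ if there is $M\in\mathcal{I}^*$ such that the function $g:S\to X$ with $g(s)=f(s)$ for $s\in M$ and $g(s)=x$ for $s\notin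 M$ is $\mathcal{M}$-convergent to $x$. Taking $\mathcal{M}$ to be $\mathcal{K}$-convergence gives $\mathcal{I}^{\mathcal{K}}$-convergence. $\mathcal{J}^*$-convergence is $\mathcal{J}^{Fin}$-convergence, i.e. there is $M\in\mathcal{J}^*$ such that the corresponding $g$ is $Fin$-convergent to $x$. Taking $\mathcal{M}$ to be $\mathcal{K}^*$-convergence gives $\mathcal{I}^{\mathcal{K}^*}$-convergence. *)

(* Defs.v *)
From mathcomp Require Import all_boot.
From mathcomp Require Import boolp classical_sets functions cardinality.
From mathcomp Require Import filter topology_structure.

Set Implicit Arguments.
Unset Strict Implicit.
Unset Printing Implicit Defensive.

Local Open Scope classical_set_scope.

Definition Fin (S : Type) : set (set S) := [set A | finite_set A].
Arguments Fin S : clear implicits.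

(* Proper ideals containing all finite subsets; closure under the empty union
   follows from [ideal_fin]. *)
Record ideal (S : Type) (I : set (set S)) : Prop := Ideal {
  ideal_setU : forall A B, I A -> I B -> I (A `|` B);
  ideal_sub : forall A B, A `<=` B -> I B -> I A;
  ideal_fin : Fin S `<=` I;
  ideal_proper : ~ I setT
}.

Definition dual (S : Type) (I : set (set S)) : set (set S) :=
  [set A | I (~` A)].

(* Elementwise unions of a member of I and a member of K, not the
   set-theoretic union of the two families. *)
Definition idealU (S : Type) (I K : set (set S)) : set (set S) :=
  [set A `|` B | A in I & B in K].

Definition conv_mode (S : Type) (X : topologicalType) := (S -> X) -> X -> Prop.

Definition ideal_cvg (S : Type) (X : topologicalType) (J : set (set S)) :
    conv_mode S X :=
  fun f x => forall U, nbhs x U -> J [set s | ~ U (f s)].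

(* [patch (fun=> x) M f] is f on M and constantly x off M. *)
Definition mode_cvg (S : Type) (X : topologicalType) (I : set (set S))
    (M : conv_mode S X) : conv_mode S X :=
  fun f x => exists2 A, dual I A & M (patch (fun=> x) A f) x.

Definition star_cvg (S : Type) (X : topologicalType) (J : set (set S)) :
    conv_mode S X :=
  mode_cvg J (ideal_cvg (Fin S)).

(* Main.v *)
(* Patching by x off A and then off B is patching off A `&` B, whose complement
   is ~` A `|` ~` B; hence iterating the two convergence modes amounts to one
   patch off a set in the dual of the elementwise union of the ideals. *)
Require Import Defs.
From mathcomp Require Import all_boot.
From mathcomp Require Import boolp classical_sets functions cardinality.
From mathcomp Require Import filter topology_structure.

Local Open Scope classical_set_scope.

Lemma patch_patch (S T : Type) (d f : S -> T) (A B : set S) :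
  patch d B (patch d A f) = patch d (A `&` B) f.
Proof. by apply/funext => s; rewrite /patch in_setI; do 2 case: (_ \in _). Qed.

Lemma mode_cvg_star (S : Type) (X : topologicalType) (I K : set (set S))
    (f : S -> X) (x : X) :
  mode_cvg I (star_cvg K) f x <-> star_cvg (idealU I K) f x.
Proof.
split=> [[A IA [B KB fAB]]|[M [C IC [D KD CDM]] fM]].
  exists (A `&` B); last by rewrite -patch_patch.
  by exists (~` A) => //; exists (~` B) => //; rewrite setCI.
(* The complement of [M] is [C] together with [D], so the single patch off it splits: first off [C],
   then off [D]. *)
exists (~` C); first by rewrite /dual /= setCK.
exists (~` D); first by rewrite /dual /= setCK.
by rewrite patch_patch -setCU CDM setCK.
Qed.

(** Patching alters [f] only on a member of [I], so outside that set [f] leaves [U] exactly where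
    its patch does. *)
Lemma mode_cvg_ideal_cvg (S : Type) (X : topologicalType) (I K : set (set S))
    (f : S -> X) (x : X) :
  ideal (idealU I K) ->
  mode_cvg I (ideal_cvg K) f x -> ideal_cvg (idealU I K) f x.
Proof.
move=> hIK [A IA fA] U xU.
(* Only an inclusion holds, as [f] may stay in [U] at points off [A]; hence downward closure. *)
apply: (ideal_sub hIK); last first.
  by exists (~` A) => //; exists [set s | ~ U (patch (fun=> x) A f s)] => //; apply: fA.
move=> s /= nUfs; have [As|nAs] := pselect (A s); last by left.
by right; rewrite /patch mem_set.
Qed.

Theorem proposition2p1 (S : Type) (X : topologicalType) (f : S -> X) (x : X)
    (I K : set (set S)) (hI : ideal I) (hK : ideal K)
    (hIK : ideal (idealU I K)) :
  (mode_cvg I (star_cvg K) f x <-> star_cvg (idealU I K) f x) /\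
  (mode_cvg I (ideal_cvg K) f x -> ideal_cvg (idealU I K) f x).
Proof. by split; [exact: mode_cvg_star | exact: mode_cvg_ideal_cvg]. Qed.
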